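(* Let $k$ be an algebraically closed field of characteristic zero, let $G=\mathrm{Paut}(f)$ be the projective automorphism group of a nonsingular quartic form $f\in k[x,y,z,t]$, and let $|G|=\prod_p p^{\nu(p)}$ be the decomposition of $|G|$ into prime factors. Then $\nu(p)=0$ for every prime $p\geq 11$.
   Context: A quartic form is a homogeneous polynomial of degree $4$; it is nonsingular if it is nonzero and the projective algebraic set $V_p(f)\subset\mathbf{P}^3(k)$ is nonsingular. For $A\in GL_4(k)$, $f_{A^{-1}}$ denotes the form $v\mapsto f(Av)$, $(A)$ is the class of $A$ in $PGL_4(k)$, and $\mathrm{Paut}(f)=\{(A)\in PGL_4(k): f_{A^{-1}}=cf \text{ for some } c\in k^*\}$; it is a finite group when $f$ is nonsingular of degree $\geq 3$. *)

(* Defs.v *)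
From HB Require Import structures.
From mathcomp Require Import all_boot all_algebra.
From mathcomp Require Import mpoly.

Set Implicit Arguments.
Unset Strict Implicit.
Unset Printing Implicit Defensive.

Import GRing.Theory.
Local Open Scope ring_scope.
Local Open Scope quotient_scope.

Section PGL.
Variables (k : fieldType) (n : nat).

(* The library's general linear groups are restricted to finite rings. *)
Record GLn := MkGLn { GLn_mx :> 'M[k]_n; GLnP : GLn_mx \in unitmx }.

HB.instance Definition _ := [isSub for GLn_mx].
HB.instance Definition _ := [Choice of GLn by <:].

Definition GL1 : GLn := MkGLn (unitmx1 k n).

Lemma GLmul_subproof (A B : GLn) : A *m B \in unitmx.
Proof. by rewrite unitmx_mul !GLnP. Qed.
Definition GLmul (A B : GLn) : GLn := MkGLn (GLmul_subproof A B).

Lemma GLinv_subproof (A : GLn) : invmx A \in unitmx.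
Proof. by rewrite unitmx_inv GLnP. Qed.
Definition GLinv (A : GLn) : GLn := MkGLn (GLinv_subproof A).

Lemma GLmulA : associative GLmul.
Proof. by move=> A B C; apply: val_inj; rewrite /= mulmxA. Qed.
Lemma GLmul1l : left_id GL1 GLmul.
Proof. by move=> A; apply: val_inj; rewrite /= mul1mx. Qed.
Lemma GLmul1r : right_id GL1 GLmul.
Proof. by move=> A; apply: val_inj; rewrite /= mulmx1. Qed.
Lemma GLmulVl : left_inverse GL1 GLinv GLmul.
Proof. by move=> A; apply: val_inj; rewrite /= mulVmx ?GLnP. Qed.
Lemma GLmulVr : right_inverse GL1 GLinv GLmul.
Proof. by move=> A; apply: val_inj; rewrite /= mulmxV ?GLnP. Qed.

HB.instance Definition _ :=
  isGroup.Build GLn GLmulA GLmul1l GLmul1r GLmulVl GLmulVr.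

(* Equality of the cosets of A and B modulo the subgroup of scalar matrices. *)
Definition pgl_rel (A B : GLn) : bool := is_scalar_mx (invmx A *m B).

Lemma pgl_relP (A B : GLn) :
  reflect (exists c : k, (B : 'M_n) = c *: (A : 'M_n)) (pgl_rel A B).
Proof.
apply: (iffP is_scalar_mxP) => -[c e]; exists c.
  by rewrite -mul_mx_scalar -e mulKVmx ?GLnP.
by rewrite e -scalemxAr mulVmx ?GLnP // scalemx1.
Qed.

Lemma pgl_rel_refl : reflexive pgl_rel.
Proof. by move=> A; apply/pgl_relP; exists 1; rewrite scale1r. Qed.

Lemma pgl_rel_sym : ssrbool.symmetric pgl_rel.
Proof.
suff h A B : pgl_rel A B -> pgl_rel B A by move=> A B; apply/idP/idP; apply: h.
move=> /is_scalar_mxP[c e]; apply/is_scalar_mxP; exists c^-1.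
have uM : invmx A *m B \in unitmx by rewrite unitmx_mul unitmx_inv !GLnP.
rewrite -invmx_scalar -e -[LHS](mulmxK uM) -[_ *m A *m _]mulmxA.
by rewrite mulKVmx ?GLnP // mulVmx ?GLnP // mul1mx.
Qed.

Lemma pgl_rel_trans : transitive pgl_rel.
Proof.
move=> B A C /pgl_relP[c eB] /pgl_relP[d eC]; apply/pgl_relP.
by exists (d * c); rewrite eC eB scalerA.
Qed.

Canonical pgl_equiv :=
  EquivRel pgl_rel pgl_rel_refl pgl_rel_sym pgl_rel_trans.

Definition PGL := {eq_quot pgl_equiv}.

HB.instance Definition _ := Choice.on PGL.
HB.instance Definition _ := EqQuotient.on PGL.

Definition pgl_class (A : GLn) : PGL := \pi_PGL A.

Lemma pgl_class_eq (A B : GLn) :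
  pgl_class A = pgl_class B <-> exists c : k, (B : 'M_n) = c *: (A : 'M_n).
Proof. by split=> [/eqmodP/pgl_relP | /pgl_relP e]; last exact/eqmodP. Qed.

Definition PGL1 : PGL := pgl_class GL1.
Definition PGLmul (x y : PGL) : PGL := pgl_class (GLmul (repr x) (repr y)).
Definition PGLinv (x : PGL) : PGL := pgl_class (GLinv (repr x)).

Lemma pgl_repr (x : PGL) : pgl_class (repr x) = x.
Proof. exact: reprK. Qed.

Lemma PGLmulE (A B : GLn) :
  PGLmul (pgl_class A) (pgl_class B) = pgl_class (GLmul A B).
Proof.
have /pgl_class_eq[c ea] := pgl_repr (pgl_class A).
have /pgl_class_eq[d eb] := pgl_repr (pgl_class B).
apply/pgl_class_eq; exists (c * d) => /=.
by rewrite ea eb -scalemxAl -scalemxAr scalerA.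
Qed.

Lemma PGLinvE (A : GLn) : PGLinv (pgl_class A) = pgl_class (GLinv A).
Proof.
have /esym/eqmodP/is_scalar_mxP[c e] := pgl_repr (pgl_class A).
apply/pgl_class_eq; exists c => /=.
by rewrite -[in RHS]mul_scalar_mx -e mulmxK ?GLnP.
Qed.

Lemma PGLmulA : associative PGLmul.
Proof.
by move=> x y z; rewrite -(pgl_repr x) -(pgl_repr y) -(pgl_repr z)
  !PGLmulE GLmulA.
Qed.
Lemma PGLmul1l : left_id PGL1 PGLmul.
Proof. by move=> x; rewrite -(pgl_repr x) PGLmulE GLmul1l. Qed.
Lemma PGLmul1r : right_id PGL1 PGLmul.
Proof. by move=> x; rewrite -(pgl_repr x) PGLmulE GLmul1r. Qed.
Lemma PGLmulVl : left_inverse PGL1 PGLinv PGLmul.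
Proof. by move=> x; rewrite -(pgl_repr x) PGLinvE PGLmulE GLmulVl. Qed.
Lemma PGLmulVr : right_inverse PGL1 PGLinv PGLmul.
Proof. by move=> x; rewrite -(pgl_repr x) PGLinvE PGLmulE GLmulVr. Qed.

HB.instance Definition _ :=
  isGroup.Build PGL PGLmulA PGLmul1l PGLmul1r PGLmulVl PGLmulVr.

End PGL.

Section Forms.
Variables (k : fieldType) (n : nat).
Implicit Type f : {mpoly k[n]}.

(* Jacobian criterion at every point of the projective hypersurface, points of
   projective space being given by nonzero vectors of homogeneous coordinates.
   The hypersurface is taken with the structure given by f, so a form with a
   repeated factor is singular. *)
Definition nonsingular f : Prop :=
  f != 0 /\
  forall v : 'I_n -> k, (exists i, v i != 0) -> f.@[v] = 0 ->
    exists i, (mderiv i f).@[v] != 0.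

(* The form v |-> f (A v), for column vectors v. *)
Definition form_subst f (A : 'M[k]_n) : {mpoly k[n]} :=
  f \mPo [tuple \sum_(j < n) A i j *: 'X_j | i < n].

Lemma form_subst_eval f A (v : 'cV[k]_n) :
  (form_subst f A).@[fun i => v i 0] = f.@[fun i => (A *m v) i 0].
Proof.
rewrite comp_mpoly_meval; apply: meval_eq => i.
rewrite tnth_mktuple mxE raddf_sum /=; apply: eq_bigr => j _.
by rewrite mevalZ mevalXU.
Qed.

Definition Paut f (x : PGL k n) : Prop :=
  exists2 A : GLn k n, x = pgl_class A &
    exists2 c : k, c != 0 & form_subst f A = c *: f.

Lemma form_subst1 f : form_subst f 1%:M = f.
Proof.
rewrite -[RHS]comp_mpoly_id; congr (_ \mPo _); apply: eq_from_tnth => i.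
rewrite !tnth_mktuple (bigD1 i) //= mxE eqxx scale1r big1 ?addr0 // => j ji.
by rewrite mxE eq_sym (negPf ji) scale0r.
Qed.

Lemma form_substM f A B :
  form_subst (form_subst f A) B = form_subst f (A *m B).
Proof.
rewrite /form_subst [X in X \mPo _]comp_mpolyE [RHS]comp_mpolyE raddf_sum /=.
apply: eq_bigr => m _; rewrite linearZ /= rmorph_prod /=; congr (_ *: _).
apply: eq_bigr => i _; rewrite rmorphXn /= !tnth_mktuple; congr (_ ^+ _).
under [RHS]eq_bigr do rewrite mxE scaler_suml.
rewrite raddf_sum exchange_big /=; apply: eq_bigr => j _.
rewrite linearZ /= comp_mpolyXU -tnth_nth tnth_mktuple scaler_sumr.
by apply: eq_bigr => l _; rewrite scalerA.
Qed.

Lemma Paut1 f : Paut f 1%g.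
Proof.
exists (GL1 k n) => //; exists 1; first exact: oner_neq0.
by rewrite form_subst1 scale1r.
Qed.

Lemma PautM f x y : Paut f x -> Paut f y -> Paut f (x * y)%g.
Proof.
move=> [A -> [c c0 eA]] [B -> [d d0 eB]].
exists (GLmul A B); first exact: PGLmulE.
exists (c * d); first by rewrite mulf_neq0.
by rewrite -form_substM eA /form_subst comp_mpolyZ -/(form_subst _ _) eB scalerA.
Qed.

Lemma PautV f x : Paut f x -> Paut f (x^-1)%g.
Proof.
move=> [A -> [c c0 eA]]; exists (GLinv A); first exact: PGLinvE.
exists c^-1; first by rewrite invr_eq0.
apply: (scalerI c0); rewrite scalerA mulfV // scale1r.
rewrite /form_subst -comp_mpolyZ -eA -/(form_subst _ _) form_substM /=.
by rewrite mulmxV ?GLnP // form_subst1.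
Qed.

End Forms.

Definition has_order (T : eqType) (G : T -> Prop) (m : nat) : Prop :=
  exists s : seq T, [/\ uniq s, forall x, x \in s <-> G x & size s = m].

Lemma has_order_inj (T : eqType) (G : T -> Prop) m1 m2 :
  has_order G m1 -> has_order G m2 -> m1 = m2.
Proof.
move=> [s1 [u1 h1 <-]] [s2 [u2 h2 <-]]; apply/perm_size/uniq_perm => // x.
by apply/idP/idP => [/h1/h2 | /h2/h1].
Qed.

(* Main.v *)
(* By Cauchy's theorem it suffices to exclude elements of prime order p >= 11.
   Such an element lifts to a matrix A whose p-th power is scalar; A has an
   eigenbasis v_i with eigenvalues a_i, and f (A v) = c f v. Nonsingularity of
   f at v_i gives a j = sigma i with a_i ^ 3 a_j = c: take j = i if
   f (v_i) <> 0, and otherwise a v_j on which the gradient of f at v_i does not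
   vanish. The ratios w_i = a_i / a_(sigma i) are p-th roots of unity with
   w_(sigma i) = w_i ^ -3, and following a cycle of sigma forces w_i = 1 as soon
   as p does not divide 2 * 3 * 5 * 7. Hence a_i ^ 4 = c for all i, all the a_i
   are equal and A is scalar. *)
Require Import Defs.
From HB Require Import structures.
From mathcomp Require Import all_boot all_algebra.
From mathcomp Require Import fingroup cyclic pgroup separable.
From mathcomp Require Import mpoly.

Set Implicit Arguments.
Unset Strict Implicit.
Unset Printing Implicit Defensive.

Import GRing.Theory.

Local Open Scope ring_scope.

(** * Elements of prime order in a group enumerated by a finite list *)

Lemma has_order_Cauchy (gT : groupType) (G : gT -> Prop) (N p : nat) :
    G 1%g -> (forall x y, G x -> G y -> G (x * y)%g) ->
    (forall x, G x -> G (x^-1)%g) ->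
    has_order G N -> prime p -> (p %| N)%N ->
  exists x, [/\ G x, x != 1%g & (x ^+ p)%g = 1%g].
Proof.
move=> G1 GM GV [s [s_uniq sG <-]] p_pr p_dvd.
have s1 : 1%g \in s by apply/sG.
have sM (x y : seq_sub s) : (val x * val y)%g \in s.
  by apply/sG/GM; apply/sG/valP.
have sV (x : seq_sub s) : ((val x)^-1)%g \in s by apply/sG/GV/sG/valP.
pose mul x y := SeqSub (sM x y); pose inv x := SeqSub (sV x).
have mulA : associative mul by move=> x y z; apply/val_inj/mulgA.
have mul1 : left_id (SeqSub s1) mul by move=> x; apply/val_inj/mul1g.
have mulV : left_inverse (SeqSub s1) inv mul by move=> x; apply/val_inj/mulVg.
(* The group [gT] may be infinite, so the list [s] itself is turned into a finite group, to which
   Cauchy's theorem applies. *)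
pose H : finGroupType :=
  HB.pack (seq_sub s) (Finite_isGroup.Build (seq_sub s) mulA mul1 mulV).
have [|x _ ox] := @Cauchy H p [set: H]%G p_pr.
  by rewrite cardsT card_seq_sub.
have valX n : val (x ^+ n)%g = (val x ^+ n)%g.
  by elim: n => [|n IHn]; rewrite ?expg0 // !expgS -IHn.
exists (val x); split; first exact/sG/valP.
  apply: contraTneq (prime_gt1 p_pr) => x1; rewrite -ox.
  suff -> : x = 1%g by rewrite order1.
  exact: val_inj.
by rewrite -valX -ox expg_order.
Qed.

(** * Matrices with a scalar power *)

Lemma separable_Xn_subC (F : fieldType) (n : nat) (s : F) :
  n%:R != 0 :> F -> s != 0 -> separable_poly ('X^n - s%:P).
Proof.
case: n => [/eqP// | n n0 s0]; rewrite unlock derivB derivXn derivC subr0.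
rewrite -scaler_nat coprimepZr //= exprS coprimep_sym.
(* The polynomial is a multiple of ['X^n] plus the nonzero constant [- s], and its derivative is
   ['X^n] up to a unit. *)
rewrite -polyCN coprimep_addl_mul.
by rewrite -alg_polyC coprimepZr ?coprimep1 // oppr_eq0.
Qed.

(** The minimal polynomial divides ['X^m - s%:P], which splits with distinct roots, so [A] is
    diagonalizable. *)
Lemma eigenbasis_of_scalar_power (F : closedFieldType) (n m : nat)
    (A : 'M[F]_n.+1) (s : F) :
    m%:R != 0 :> F -> s != 0 -> A ^+ m = s%:M ->
  exists2 Q : 'M[F]_n.+1, Q \in unitmx &
    exists a : 'I_n.+1 -> F, forall i, A *m col i Q = a i *: col i Q.
Proof.
move=> m0 s0 As; have m_gt0 : (0 < m)%N by case: m m0 {As} => //; rewrite eqxx.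
have [rs prs] := closed_field_poly_normal ('X^m - s%:P).
rewrite (monicP (monicXnsubC _ _)) // scale1r in prs.
have rs_uniq : uniq rs.
  by rewrite -separable_prod_XsubC -prs separable_Xn_subC.
(* Diagonalization is stated for row eigenvectors; transposing turns them into columns. *)
have [|P Pu /mxpoly.diagonalizable_forPex[d]] :=
    proj2 (mxpoly.diagonalizableP A^T).
  exists rs => //; rewrite -prs; apply: mxminpoly_min.
  rewrite rmorphB rmorphXn /= horner_mx_X horner_mx_C.
  have -> : A^T ^+ m = (A ^+ m)^T.
    elim: (m) => [|i IHi]; first by rewrite !expr0 trmx1.
    by rewrite exprS exprSr IHi -[LHS]/(_ *m _) -trmx_mul.
  by rewrite As tr_scalar_mx subrr.
move=> /(mxpoly.simmxP Pu) PA; exists P^T; first by rewrite unitmx_tr.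
exists (d 0) => i; apply: trmx_inj; rewrite trmx_mul linearZ /= tr_col trmxK.
by rewrite -row_mul PA mul_diag_mx; apply/rowP => l; rewrite !mxE.
Qed.

(** * Gradients of forms under linear substitution *)

Lemma mderiv_XU (R : nzRingType) (n : nat) (i j : 'I_n) :
  mderiv i ('X_j : {mpoly R[n]}) = (i == j)%:R.
Proof.
rewrite mderivX mnm1E eq_sym; case: eqP => [->|_]; last by rewrite scale0r.
rewrite scale1r (_ : (_ - _)%MM = 0%MM) ?mpolyX0 //.
by apply/mnmP => l; rewrite mnmBE subnn mnm0E.
Qed.

Section Gradient.
Variables (k : fieldType) (n : nat).
Implicit Type f : {mpoly k[n]}.

(** The chain rule is stable under sums and products and holds for constants and variables, hence
    for every polynomial. *)
Lemma mderiv_comp_mpoly (l : nat) (f : {mpoly k[l]})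
    (t : l.-tuple {mpoly k[n]}) (i : 'I_n) :
  mderiv i (f \mPo t) = \sum_(j < l) (mderiv j f \mPo t) * mderiv i (tnth t j).
Proof.
pose chain g :=
  mderiv i (g \mPo t) = \sum_j (mderiv j g \mPo t) * mderiv i (tnth t j).
have chainD g h : chain g -> chain h -> chain (g + h).
  move=> cg ch; rewrite /chain comp_mpolyD mderivD cg ch -big_split /=.
  by apply: eq_bigr => j _; rewrite mderivD comp_mpolyD mulrDl.
have chainM g h : chain g -> chain h -> chain (g * h).
  move=> cg ch; rewrite /chain rmorphM /= mderivM cg ch mulr_suml mulr_sumr.
  rewrite -big_split /=; apply: eq_bigr => j _.
  by rewrite mderivM comp_mpolyD !rmorphM /= mulrDl mulrAC mulrA.
have chainC c : chain c%:MP.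
  rewrite /chain comp_mpolyC mderivC big1 // => j _.
  by rewrite mderivC comp_mpoly0 mul0r.
have chainX j : chain 'X_j.
  rewrite /chain comp_mpolyXU -tnth_nth (bigD1 j) //= big1 ?addr0.
    by rewrite mderiv_XU eqxx comp_mpoly1 mul1r.
  by move=> q /negPf qj; rewrite mderiv_XU qj comp_mpoly0 mul0r.
elim/mpolyind: f => [|c m f _ _ cf]; first exact: (chainC 0).
apply: (chainD) => //; rewrite -mul_mpolyC; apply: (chainM) => //.
rewrite mpolyXE_id; apply: (big_ind chain) => //; first exact: (chainC 1).
move=> j _; elim: (m j) => [|e IHe]; first exact: (chainC 1).
by rewrite exprS; apply: chainM.
Qed.

Lemma meval_homogZ f (d : nat) (a : k) (v : 'I_n -> k) :
  f \is d.-homog -> f.@[fun i => a * v i] = a ^+ d * f.@[v].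
Proof.
move=> /dhomogP fh; rewrite !mevalE mulr_sumr; apply: eq_big_seq => m /fh dm.
rewrite mulrCA; congr (_ * _).
under eq_bigr do rewrite exprMn.
by rewrite big_split /= prodrXr -mdegE; congr (_ ^+ _ * _).
Qed.

Lemma mderiv_homog f (d : nat) (i : 'I_n) :
  f \is d.+1.-homog -> mderiv i f \is d.-homog.
Proof.
move=> /dhomogP fh; apply/dhomogP => m.
rewrite mcoeff_msupp mcoeff_mderiv => nz.
have /fh : (m + U_(i))%MM \in msupp f.
  by rewrite mcoeff_msupp; apply: contraNneq nz => ->; rewrite mul0rn.
by rewrite /= mdegD mdeg1 addn1 => -[].
Qed.

(** As a row, the gradient pairs with a column direction by a matrix product, and the chain rule for
    [A] becomes right multiplication by [A]. *)
Definition grad f (v : 'cV[k]_n) : 'rV[k]_n :=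
  \row_i (mderiv i f).@[fun l => v l 0].

Lemma grad_form_subst f (A : 'M[k]_n) (v : 'cV[k]_n) :
  grad (form_subst f A) v = grad f (A *m v) *m A.
Proof.
apply/rowP => i; rewrite !mxE mderiv_comp_mpoly raddf_sum /=.
apply: eq_bigr => j _; rewrite mevalM form_subst_eval mxE; congr (_ * _).
rewrite tnth_mktuple [mderiv i _]linear_sum raddf_sum /= (bigD1 i) //= big1 ?addr0.
  by rewrite mderivZ mderiv_XU eqxx mevalZ meval1 mulr1.
move=> l li; rewrite mderivZ mderiv_XU eq_sym (negPf li) mevalZ meval0.
by rewrite mulr0.
Qed.

Lemma gradZ f (d : nat) (a : k) (v : 'cV[k]_n) :
  f \is d.+1.-homog -> grad f (a *: v) = a ^+ d *: grad f v.
Proof.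
move=> fh; apply/rowP => i; rewrite !mxE -meval_homogZ ?mderiv_homog //.
by apply: meval_eq => l; rewrite mxE.
Qed.

End Gradient.

(** * Roots of unity along the orbits of a self-map *)

Lemma eq1_of_coprime_exponents (R : nzRingType) (m n : nat) (x : R) :
  coprime m n -> x ^+ m = 1 -> x ^+ n = 1 -> x = 1.
Proof.
(* The Bezout relation [a * m = b * n + 1] in natural numbers needs [m] positive; for [m = 0]
   coprimality forces [n = 1]. *)
case: m => [|m] mn xm xn; first by move: mn xn; rewrite /coprime gcd0n => /eqP ->.
have [a b ab _] := egcdnP n (ltn0Sn m).
have := congr1 (fun e => x ^+ e) ab.
by rewrite /= (eqP mn) exprD mulnC exprM xm expr1n mulnC exprM xn expr1n mul1r.
Qed.

(* On the cycle that the orbit of [i] reaches, whose length is at most 4,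
   [w] is killed by one of 3 + 1, 3 ^ 2 - 1, 3 ^ 3 + 1, 3 ^ 4 - 1, all of which
   divide 560; going back along the orbit only needs 3 to be prime to [p]. *)
Lemma inverse_cube_orbit (F : fieldType) (sigma : 'I_4 -> 'I_4) (w : 'I_4 -> F)
    (p : nat) :
    coprime 3 p -> coprime 560 p ->
    (forall i, w i ^+ p = 1) -> (forall i, w (sigma i) * w i ^+ 3 = 1) ->
  forall i, w i = 1.
Proof.
move=> p3 p560 wp wS i; pose u n := w (iter n sigma i).
have un0 n : u n != 0.
  apply/eqP => un; have := wS (iter n sigma i); rewrite -/(u n) un.
  by rewrite expr0n mulr0 => /eqP; rewrite eq_sym oner_eq0.
have uS n : u n.+1 = (u n ^+ 3)^-1.
  by apply: (mulIf (expf_neq0 3 (un0 n))); rewrite mulVf ?expf_neq0 //; apply: wS.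
suff [n un] : exists n, u n = 1.
  elim: n un => // n IHn; rewrite uS => un; apply: IHn.
  apply: eq1_of_coprime_exponents p3 _ (wp _).
  by rewrite -[LHS]invrK un invr1.
(* Pigeonhole: five iterates among four indices. *)
have /injectivePn[m0 [n0 mn0 smn0]] : ~~ injectiveb (fun n : 'I_5 => iter n sigma i).
  by apply/injectiveP => /leq_card; rewrite !card_ord.
have {m0 n0 mn0 smn0} [m [r [r_gt0 r_le4 umr]]] :
    exists m r, [/\ (0 < r)%N, (r <= 4)%N & u (r + m)%N = u m].
  wlog lt_mn : m0 n0 mn0 smn0 / (m0 < n0)%N => [th|].
    have := mn0; rewrite -(inj_eq val_inj) neq_ltn.
    by case/orP => [/(th _ _ mn0 smn0)|]; last apply: th; rewrite // eq_sym.
  exists m0, (n0 - m0)%N; rewrite subn_gt0 lt_mn subnK ?(ltnW lt_mn) //.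
  by rewrite (leq_trans (leq_subr _ _)) -1?ltnS // /u smn0.
exists m; apply: eq1_of_coprime_exponents p560 _ (wp _).
have cancelV e : u m = (u m ^+ e)^-1 -> u m ^+ e.+1 = 1.
  by rewrite exprS => {1}->; rewrite mulVf ?expf_neq0.
have cancelX e : u m = u m ^+ e.+1 -> u m ^+ e = 1.
  by move=> um; apply: (mulfI (un0 m)); rewrite -exprS -um mulr1.
have div560 e : (e %| 560)%N -> u m ^+ e = 1 -> u m ^+ 560 = 1.
  by case/dvdnP => q ->; rewrite mulnC exprM => ->; rewrite expr1n.
move/esym: umr; case: r r_gt0 r_le4 => [|[|[|[|[|r]]]]] // _ _;
  rewrite !addSn add0n !uS ?(exprVn, invrK) -?exprM.
- by move/cancelV; apply: div560.
- by move/cancelX; apply: div560.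
- by move/cancelV; apply: div560.
- by move/cancelX; apply: div560.
Qed.

(** * Automorphisms of nonsingular quartic forms *)

Lemma scalar_of_scalar_power (k : closedFieldType) (f : {mpoly k[4]})
    (A : 'M[k]_4) (c s : k) (p : nat) :
    [pchar k] =i pred0 -> f \is 4.-homog -> nonsingular f ->
    prime p -> (11 <= p)%N -> A ^+ p = s%:M -> s != 0 ->
    form_subst f A = c *: f -> c != 0 -> is_scalar_mx A.
Proof.
move=> k0 fh [_ f_ns] p_pr p_ge As s0 fA c0.
have p0 : p%:R != 0 :> k.
  by rewrite (proj1 (pcharf0P _) k0) -lt0n prime_gt0.
(* The bound on [p] enters here: [p] is prime to every positive integer whose prime factors are
   below 11, such as 3, 4 and 560. *)
have coprime_p m : all (fun q => q < 11)%N (primes m) -> (0 < m)%N -> coprime m p.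
  move=> /allP m_small m0; rewrite coprime_sym prime_coprime //.
  apply: contraL p_ge => pm; rewrite -ltnNge; apply: m_small.
  by rewrite mem_primes p_pr m0.
have [Q Qu [a Av]] := eigenbasis_of_scalar_power p0 s0 As.
pose v i := col i Q; have {}Av i : A *m v i = a i *: v i by apply: Av.
have v0 i : v i != 0.
  apply/eqP => vi; have := congr1 (mulmx (invmx Q)) vi.
  rewrite /v colE mulKmx // mulmx0 => /colP/(_ i); rewrite !mxE eqxx.
  by move/eqP; rewrite oner_eq0.
have Apv i n : A ^+ n *m v i = a i ^+ n *: v i.
  elim: n => [|n IHn]; first by rewrite !expr0 mul1mx scale1r.
  by rewrite exprSr -[_ * A]/(_ *m A) -mulmxA Av -scalemxAr IHn scalerA exprS.
have ap i : a i ^+ p = s.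
  have := Apv i p; rewrite As mul_scalar_mx => /eqP; rewrite -subr_eq0 -scalerBl.
  by rewrite scaler_eq0 (negPf (v0 i)) orbF subr_eq0 => /eqP.
(* Differentiate [f (A v) = c f v] at [v i]; the gradient is homogeneous of degree 3 and
   [A *m v i = a i *: v i]. *)
have gradA i : c *: grad f (v i) = a i ^+ 3 *: (grad f (v i) *m A).
  rewrite scalemxAl -(gradZ _ _ fh) -Av -grad_form_subst fA.
  by apply/rowP => l; rewrite !mxE mderivZ mevalZ.
have /fin_all_exists[sigma a_sigma] i : exists j, a i ^+ 3 * a j = c.
  have [fv|fv] := eqVneq f.@[fun l => v i l 0] 0; last first.
    exists i; apply: (mulIf fv); rewrite -exprSr -(meval_homogZ _ _ fh) -mevalZ -fA.
    by rewrite form_subst_eval Av; apply: meval_eq => l; rewrite [RHS]mxE.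
  have [|l gl] := f_ns _ _ fv.
    by have /matrix0Pn[l [z vl]] := v0 i; exists l; rewrite [z]ord1 in vl *.
  (* The entries of this row are the derivatives of [f] at [v i] along the [v j]; as [Q] is
     invertible, one of them is nonzero. *)
  have : grad f (v i) *m Q != 0.
    apply: contraNneq gl => gQ; have := mulmxK Qu (grad f (v i)).
    by rewrite gQ mul0mx => /rowP/(_ l); rewrite !mxE => <-.
  case/matrix0Pn => z [j]; rewrite [z]ord1 => gj; exists j.
  have {}gj : (grad f (v i) *m v j) 0 0 != 0.
    by rewrite [v j]colE mulmxA -colE mxE.
  apply: (mulIf gj); have := congr1 (fun M => (M *m v j) 0 0) (gradA i).
  by rewrite /= -!scalemxAl -mulmxA Av -scalemxAr !mxE mulrA.
have a0 i : a i != 0.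
  by apply: contra_neq s0 => ai; rewrite -(ap i) ai expr0n gtn_eqF ?prime_gt0.
have w1 := @inverse_cube_orbit k sigma (fun i => a i / a (sigma i)) p.
have {}w1 i : a i = a (sigma i).
  apply/(divIf (a0 (sigma i))); rewrite divff //; apply: w1 => //.
  - exact: coprime_p.
  - exact: coprime_p.
  - by move=> j; rewrite expr_div_n !ap divff.
  (* The product regroups as [a j ^+ 3 * a (sigma j)] over the same expression at [sigma j], that
     is, [c / c]. *)
  move=> j; rewrite expr_div_n mulrACA -invfM ![a (sigma _) * _]mulrC.
  by rewrite !a_sigma divff.
have a4 i : a i ^+ 4 = c by rewrite exprSr {2}w1.
(* The ratio [a i / a 0] is both a fourth and a [p]-th root of unity. *)
have aE i : a i = a 0.
  apply/(divIf (a0 0)); rewrite divff //.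
  apply: (@eq1_of_coprime_exponents _ 4 p); first exact: coprime_p.
    by rewrite expr_div_n !a4 divff.
  by rewrite expr_div_n !ap divff.
(* It suffices to compare [A *m Q] with [a 0 *: Q], column by column. *)
apply/is_scalar_mxP; exists (a 0); apply: (can_inj (mulmxK Qu)).
rewrite mul_scalar_mx; apply/matrixP => l i; have /colP/(_ l) := Av i.
by rewrite aE /v [col i Q in LHS]colE mulmxA -colE !mxE.
Qed.

Theorem corollary5p3 (k : closedFieldType) (k_char0 : [pchar k] =i pred0)
    (f : {mpoly k[4]}) (f_quartic : f \is 4.-homog)
    (f_nonsing : nonsingular f)
    (N : nat) (order_G : has_order (Paut f) N) :
  forall p : nat, prime p -> (11 <= p)%N -> logn p N = 0%N.
Proof.
move=> p p_pr p_ge; apply/eqP; rewrite -leqn0 leqNgt logn_gt0 mem_primes.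
apply/negP => /and3P[_ _ p_dvd].
have [x [Gx x1 xp]] := has_order_Cauchy (Paut1 f) (@PautM _ _ f) (@PautV _ _ f)
  order_G p_pr p_dvd.
have [A xA [c c0 fA]] := Gx.
(* Products in [PGL] pass through chosen representatives, so the induction carries along a lift of
   [x ^+ n] whose matrix is exactly [A ^+ n]. *)
have xX n : exists2 B : GLn k 4, (x ^+ n)%g = pgl_class B & (B : 'M_4) = (A : 'M_4) ^+ n.
  elim: n => [|n [B xB BA]]; first by exists (GL1 k 4).
  exists (GLmul A B); first by rewrite expgS xB xA; apply: PGLmulE.
  by rewrite /= BA exprS.
have [B xB BA] := xX p.
have /esym/pgl_class_eq[s /= Bs] : pgl_class B = pgl_class (GL1 k 4) by rewrite -xB xp.
have /is_scalar_mxP[a Aa] : is_scalar_mx (A : 'M_4).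
  apply: (scalar_of_scalar_power (s := s) (p := p)) fA c0 => //.
    by rewrite -BA Bs scalemx1.
  (* Equality of classes gives a scalar not known to be nonzero; invertibility of [B] excludes
     [s = 0]. *)
  apply: contraTneq (GLnP B) => s0.
  by rewrite Bs s0 scale0r unitmxE det0 unitr0.
case/eqP: x1; rewrite xA; apply/esym/pgl_class_eq; exists a.
by rewrite /= Aa scalemx1.
Qed.
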